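(* Let $X$ be a Banach space with $\dim X\ge2$ and let $0\le\nu\le1$. If $H_\nu(X,B)<2$, then $X$ is uniformly non-square.
   Context: $S_X$ is the unit sphere of $X$. For $x,y\in X$, $x\perp_B y$ (Birkhoff orthogonality) means $\|x+\lambda y\|\ge\|x\|$ for all real $\lambda$. For $0\le\nu\le1$, $$H_\nu(X,B)=\sup\left\{\frac{\|x+y\|^{\nu}\|x-y\|^{1-\nu}+\|x+y\|^{1-\nu}\|x-y\|^{\nu}}{2}:\ x,y\in S_X,\ x\perp_B y\right\}.$$ $X$ is uniformly non-square if there exists $\delta>0$ such that for all $x,y\in S_X$ either $\frac{\|x-y\|}{2}\le1-\delta$ or $\frac{\|x+y\|}{2}\le1-\delta$. *)

(* Defs.v *)
From HB Require Import structures.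
From mathcomp Require Import all_boot all_order all_algebra.
From mathcomp Require Import all_classical all_reals all_analysis.
Import numFieldNormedType.Exports.
Import Order.TTheory GRing.Theory Num.Theory.
Set Implicit Arguments.
Unset Strict Implicit.
Unset Printing Implicit Defensive.

Local Open Scope classical_set_scope.
Local Open Scope ring_scope.

(* [X] may be infinite dimensional: "dim X >= n" means that [X] contains [n]
   linearly independent vectors. *)
Definition dim_ge (R : realType) (X : lmodType R) (n : nat) : Prop :=
  exists v : 'I_n -> X, forall c : 'I_n -> R,
    \sum_(i < n) c i *: v i = 0 -> forall i, c i = 0.

Definition unit_sphere (R : realType) (X : normedModType R) : set X :=
  [set x | `|x| = 1].
Arguments unit_sphere {R} X.

Definition birkhoff_orth (R : realType) (X : normedModType R) (x y : X) : Prop :=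
  forall l : R, `|x + l *: y| >= `|x|.

(* For [0 <= nu <= 1] the set is bounded above by 2, and it is nonempty when
   [dim X >= 2], so the default value 0 of [sup] plays no role there. For unit
   vectors Birkhoff orthogonality forces |x + y|, |x - y| >= 1, so neither does
   the value of [powR] at 0. *)
Definition Hnu (R : realType) (X : normedModType R) (nu : R) : R :=
  sup [set h : R | exists x y : X,
    [/\ unit_sphere X x, unit_sphere X y, birkhoff_orth x y &
        h = (`|x + y| `^ nu * `|x - y| `^ (1 - nu)
             + `|x + y| `^ (1 - nu) * `|x - y| `^ nu) / 2]].
Arguments Hnu {R} X nu.

Definition uniformly_non_square (R : realType) (X : normedModType R) : Prop :=
  exists2 delta : R, 0 < delta &
    forall x y : X, unit_sphere X x -> unit_sphere X y ->
      `|x - y| / 2 <= 1 - delta \/ `|x + y| / 2 <= 1 - delta.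
Arguments uniformly_non_square {R} X.

(* Main.v *)
(** If [|x + y|] and [|x - y|] are both close to 2 for unit vectors [x], [y],
then the norm on their span is close to that of l_1, so that [a |-> |y + a x|]
attains its minimum at a point [a] close to 0.  The minimality says that
[y + a x] is Birkhoff orthogonal to [x]; normalizing it, one gets a unit vector
[w], orthogonal to [x] and close to [y], hence [|w + x|] and [|w - x|] are close
to 2 as well, and so is the corresponding term of [Hnu]. *)

Require Import Defs.
From mathcomp Require Import all_boot all_order all_algebra.
From mathcomp Require Import all_classical all_reals all_analysis.
From mathcomp Require Import lra.
Import numFieldNormedType.Exports.
Import Order.TTheory GRing.Theory Num.Theory.
Set Implicit Arguments.
Unset Strict Implicit.
Unset Printing Implicit Defensive.

Local Open Scope ring_scope.

Lemma powR_convexM (R : realType) (c nu : R) :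
  0 <= c -> c `^ nu * c `^ (1 - nu) = c.
Proof.
move=> c0; rewrite -powRD ?subrKC ?powRr1 //.
(* [powRD] asks for [c != 0] only if the exponents sum to 0; here the sum is 1, so [c = 0] is
   covered. *)
by rewrite oner_eq0.
Qed.

Lemma powR_convexM_le (R : realType) (a b c nu : R) :
  0 <= nu <= 1 -> 0 <= a <= c -> 0 <= b <= c ->
  a `^ nu * b `^ (1 - nu) <= c.
Proof.
move=> /andP[n0 n1] /andP[a0 ac] /andP[b0 bc].
have c0 := le_trans a0 ac.
rewrite -[leRHS](powR_convexM nu) // ler_pM ?powR_ge0 //.
  by rewrite ge0_ler_powR.
by rewrite ge0_ler_powR // subr_ge0.
Qed.

Lemma powR_convexM_ge (R : realType) (a b c nu : R) :
  0 <= nu <= 1 -> 0 <= c -> c <= a -> c <= b ->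
  c <= a `^ nu * b `^ (1 - nu).
Proof.
move=> /andP[n0 n1] c0 ca cb.
rewrite -[leLHS](powR_convexM nu) // ler_pM ?powR_ge0 //.
  by rewrite ge0_ler_powR // nnegrE (le_trans c0).
by rewrite ge0_ler_powR ?subr_ge0 // nnegrE (le_trans c0).
Qed.

(** Both products in a term of [Hnu] are weighted geometric means of [|x + y|] and [|x - y|], so
    they and their average are at least [c]. The bound 2 on all terms is what lets [sup] dominate
    each of them. *)
Lemma Hnu_ge (R : realType) (X : normedModType R) (nu c : R) (x y : X) :
  0 <= nu <= 1 -> unit_sphere X x -> unit_sphere X y -> birkhoff_orth x y ->
  0 <= c -> c <= `|x + y| -> c <= `|x - y| -> c <= Hnu X nu.
Proof.
move=> nu01 x1 y1 xy c0 cD cB.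
have le2 (u v : X) : unit_sphere X u -> unit_sphere X v ->
    0 <= `|u + v| <= 2 /\ 0 <= `|u - v| <= 2.
  rewrite /unit_sphere /= => u1 v1; rewrite !normr_ge0 /=; split.
    by rewrite (le_trans (ler_normD _ _)) // u1 v1.
  by rewrite (le_trans (ler_normB _ _)) // u1 v1.
set h := (`|x + y| `^ nu * `|x - y| `^ (1 - nu)
             + `|x + y| `^ (1 - nu) * `|x - y| `^ nu) / 2.
have ch : c <= h.
  have := powR_convexM_ge nu01 c0 cD cB.
  have := powR_convexM_ge nu01 c0 cB cD.
  by rewrite /h [`|x + y| `^ (1 - nu) * _]mulrC; lra.
apply: (le_trans ch); apply: ub_le_sup; last by exists x, y.
exists 2 => _ [u [v [u1 v1 _ ->]]].
have [D2 B2] := le2 u v u1 v1.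
have := powR_convexM_le nu01 D2 B2.
have := powR_convexM_le nu01 B2 D2.
by rewrite [`|u + v| `^ (1 - nu) * _]mulrC; lra.
Qed.

Section AlmostSquare.
Variables (R : realType) (X : normedModType R).
Implicit Types (x y : X) (a e : R).

(** Triangle inequality for [y + x = (y + a *: x) + (1 - a) *: x]. *)
Lemma norm_addZ_ge x y a e : `|x| = 1 -> `|y| = 1 ->
  2 - e <= `|y + x| -> 0 <= a <= 1 -> 1 + a - e <= `|y + a *: x|.
Proof.
move=> x1 y1 exy /andP[a0 a1].
have : `|y + x| <= `|y + a *: x| + `|(1 - a) *: x|.
  by rewrite (le_trans _ (ler_normD _ _)) // -addrA -scalerDl subrKC scale1r.
by rewrite normrZ x1 ger0_norm ?subr_ge0 //; lra.
Qed.

(** From [a *: (y + x) = (y + a *: x) + (a - 1) *: y] the norm is at least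
    [a * (2 - e) - (a - 1) = 1 + a * (1 - e)]. *)
Lemma norm_addZ_ge1 x y a e : `|x| = 1 -> `|y| = 1 -> e <= 1 ->
  2 - e <= `|y + x| -> 1 <= a -> 1 <= `|y + a *: x|.
Proof.
move=> x1 y1 e1 exy a1.
have : `|a *: (y + x)| <= `|y + a *: x| + `|(a - 1) *: y|.
  rewrite (le_trans _ (ler_normD _ _)) // scalerDr scalerBl scale1r.
  by rewrite addrAC subrKC.
rewrite !normrZ y1 [`|a|]ger0_norm ?[`|a - 1|]ger0_norm ?subr_ge0 //; [|lra..].
by nra.
Qed.

Lemma birkhoff_orthZl x y a :
  a != 0 -> birkhoff_orth x y -> birkhoff_orth (a *: x) y.
Proof.
move=> a0 xy l.
have -> : a *: x + l *: y = a *: (x + (a^-1 * l) *: y).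
  by rewrite scalerDr scalerA mulrA divff ?mul1r.
by rewrite !normrZ ler_wpM2l.
Qed.

Lemma exists_birkhoff_orth x y e : `|x| = 1 -> `|y| = 1 -> e < 1 ->
  2 - e <= `|y + x| -> 2 - e <= `|y - x| ->
  exists2 a, `|a| <= e & birkhoff_orth (y + a *: x) x.
Proof.
move=> x1 y1 e1 eD eB.
have Nx1 : `|- x| = 1 by rewrite normrN.
have f_cont : continuous (fun a : R => `|y + a *: x|).
  move=> a; apply: cvg_norm; apply: cvgD; first exact: cvg_cst.
  by apply: cvgZr_tmp; exact: cvg_id.
have [||a aI amin] := @EVT_min R (fun a => `|y + a *: x|) (-1) 1.
- lra.
- exact: continuous_subspaceT.
(* Compare the minimum with the value at 0, which is [|y|]. *)
have a_le1 : `|y + a *: x| <= 1.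
  rewrite -y1 -[leRHS]/(`|y|) -{2}[y]addr0 -(scale0r x) amin // in_itv /=.
  by apply/andP; split; lra.
move: aI; rewrite in_itv /= => /andP[aN1 a1].
exists a.
  (* Either sign of [a] gives [1 + |a| - e <= |y + a *: x| <= 1], with [- x] in place of [x] when
     [a < 0]. *)
  case: (leP 0 a) => a0.
    have := @norm_addZ_ge x y a e x1 y1 eD; rewrite a0 a1 => /(_ isT).
    by rewrite ger0_norm //; lra.
  have := @norm_addZ_ge (- x) y (- a) e Nx1 y1 eB.
  rewrite scaleNr scalerN opprK ltr0_norm // => H.
  by have := H _; rewrite oppr_ge0 (ltW a0) lerNl aN1 => /(_ isT); lra.
(* The minimum over [[-1, 1]] is global: outside that interval the norm is at least 1. *)
move=> l; rewrite -addrA -scalerDl.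
case: (lerP (a + l) 1) => b1; last first.
  by rewrite (le_trans a_le1) // (@norm_addZ_ge1 x y _ e) // ltW.
case: (lerP (-1) (a + l)) => bN1.
  by apply: amin; rewrite in_itv /= bN1.
rewrite (le_trans a_le1) // -[_ *: x]opprK -scalerN -scaleNr.
by rewrite (@norm_addZ_ge1 _ y _ e) ?(ltW e1) //; lra.
Qed.

(** In [2 * e], one [e] bounds the shift [|a|] from [y] to [u], the other the cost [1 - |u| <= |a|]
    of normalizing [u]. *)
Lemma exists_unit_birkhoff_orth x y e : `|x| = 1 -> `|y| = 1 -> e < 1 ->
  2 - e <= `|y + x| -> 2 - e <= `|y - x| ->
  exists w, [/\ `|w| = 1, birkhoff_orth w x & `|y - w| <= 2 * e].
Proof.
move=> x1 y1 e1 eD eB.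
have [a ae ux] := exists_birkhoff_orth x1 y1 e1 eD eB.
set u := y + a *: x in ux.
(* Orthogonality at [l = - a], which brings [u] back to [y]. *)
have u_le1 : `|u| <= 1 by have := ux (- a); rewrite scaleNr addrK y1.
have yu : `|y - u| = `|a| by rewrite /u opprD addNKr normrN normrZ x1 mulr1.
have u_ge : 1 <= `|u| + `|a|.
  by rewrite -yu -y1 -{1}(subrKC u y) ler_normD.
have u_gt0 : 0 < `|u| by lra.
exists (`|u|^-1 *: u); split.
- by rewrite normrZ normfV normr_id mulVf ?gt_eqF.
- by apply: birkhoff_orthZl => //; rewrite invr_neq0 ?gt_eqF.
- have -> : y - `|u|^-1 *: u = (y - u) + (1 - `|u|^-1) *: u.
    by rewrite scalerBl scale1r addrA subrK.
  rewrite (le_trans (ler_normD _ _)) // yu normrZ -[X in _ * X]ger0_norm //.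
  rewrite -normrM mulrBl mul1r mulVf ?gt_eqF //.
  by rewrite ler0_norm ?subr_le0 //; lra.
Qed.

End AlmostSquare.

Theorem theorem3p1 (R : realType) (X : completeNormedModType R) (nu : R)
  (dimX : dim_ge X 2) (nu_ge0 : 0 <= nu) (nu_le1 : nu <= 1)
  (HX : Hnu X nu < 2) : uniformly_non_square X.
Proof.
have nu01 : 0 <= nu <= 1 by rewrite nu_ge0.
(* The first bound gives [e < 1] and [0 <= 2 - 3 * e]; the second gives [3 * e < 2 - Hnu X nu]. *)
pose e := Num.min (2^-1) ((2 - Hnu X nu) / 4).
have e_gt0 : 0 < e by rewrite lt_min; apply/andP; split; lra.
have [e_le1 e_leH] : e <= 2^-1 /\ e <= (2 - Hnu X nu) / 4.
  by rewrite /e !ge_min !lexx orbT.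
exists (e / 2); first by lra.
move=> x y; rewrite /unit_sphere /= => x1 y1.
case: (lerP (`|x - y| / 2) (1 - e / 2)) => [|xB]; first by left.
case: (lerP (`|x + y| / 2) (1 - e / 2)) => [|xD]; first by right.
have [|||w [w1 wx wy]] := @exists_unit_birkhoff_orth R X x y e x1 y1.
- lra.
- by rewrite [y + x]addrC; lra.
- by rewrite [`|y - x|]distrC; lra.
have yD : `|x + y| <= `|y - w| + `|w + x|.
  by rewrite (le_trans _ (ler_normD _ _)) // addrA subrK addrC.
have yB : `|x - y| <= `|y - w| + `|w - x|.
  by rewrite distrC (le_trans _ (ler_normD _ _)) // addrA subrK.
(* Replacing [y] by [w] costs [2 * e] on top of the initial [e]. Birkhoff orthogonality is not
   symmetric, so [w] must come first. *)
have : 2 - 3 * e <= Hnu X nu by apply: (Hnu_ge nu01 w1 x1 wx); lra.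
by lra.
Qed.
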